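(* Let $X$ be a compact Hausdorff space equipped with a continuous action of an amenable group $G$. Suppose that $(X,G)$ is expansive and has the weak specification property. Then $(X,G)$ has the Myhill property, i.e., every pre-injective continuous $G$-equivariant map $f \colon X \to X$ is surjective. In particular, $(X,G)$ is surjunctive, i.e., every injective continuous $G$-equivariant map $f \colon X \to X$ is surjective.
   Context: An action of a group $G$ on a topological space $X$ is continuous if $x \mapsto gx$ is continuous for every $g \in G$. A compact Hausdorff space $X$ is regarded as a uniform space with its unique compatible uniform structure, whose entourages are the neighborhoods of the diagonal in $X \times X$; a continuous action on it is uniformly continuous. A group $G$ is amenable if there is a net $(F_j)_{j\in J}$ of nonempty finite subsets of $G$ with $\lim_j |gF_j \setminus F_j|/|F_j| = 0$ for all $g \in G$. Expansive: there is an entourage $U_0$ of $X$ such that for all $x \neq y$ in $X$ there is $g \in G$ with $(gx,gy) \notin U_0$. Weak specification property: for every entourage $U$ of $X$ there is a finite subset $\Lambda \subset G$ such that for every finite sequence $\Omega_1,\dots,\Omega_n$ ($n\ge 1$) of finite subsets of $G$ with $\Omega_j \cap \Lambda\Omega_k = \varnothing$ for all distinct $j,k$, and every sequence $x_1,\dots,x_n$ of points of $X$, there is $x \in X$ with $(gx,gx_i) \in U$ for all $g \in \Omega_i$ and $1 \le i \le n$. Two points $x,y\in X$ are homoclinic if for every entourage $U$ of $X$ there is a finite subset $\Omega \subset G$ with $(gx,gy) \in U$ for all $g \in G \setminus \Omega$; this is an equivalence relation. A continuous $G$-equivariant map is pre-injective if its restriction to each homoclinicity class is injective. *)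

(* Defs.v *)
From mathcomp Require Import all_boot all_algebra.
From mathcomp Require Export finmap.
From mathcomp Require Export all_classical reals topology normedtype.

Set Implicit Arguments.
Unset Strict Implicit.
Unset Printing Implicit Defensive.

Import GRing.Theory Num.Theory numFieldNormedType.Exports.

Local Open Scope classical_set_scope.
Local Open Scope ring_scope.

Record is_directed (J : Type) (le : J -> J -> Prop) : Prop := IsDirected {
  directed_nonempty : exists j : J, True;
  directed_refl : forall i, le i i;
  directed_trans : forall i j k, le i j -> le j k -> le i k;
  directed_ub : forall i j, exists k, le i k /\ le j k }.

(* The filter of tails: [u j @[j --> net_tails le] --> l] says that the net [u]
   converges to [l]. *)
Definition net_tails (J : Type) (le : J -> J -> Prop) : set_system J :=
  filter_from [set: J] (fun j0 => [set j | le j0 j]).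

(* [R] only serves to express the limit. *)
Definition amenable (R : realType) (G : groupType) : Prop :=
  exists (J : Type) (le : J -> J -> Prop) (F : J -> {fset G}),
    [/\ is_directed le,
        forall j, F j <> fset0 &
        forall g : G,
          (#|` [fset (g * h)%g | h in F j] `\` F j|%fset%:R / #|` F j|%fset%:R : R)
            @[j --> net_tails le] --> (0 : R)].

Record continuous_action (G : groupType) (X : topologicalType)
    (act : G -> X -> X) : Prop := ContinuousAction {
  act1 : forall x, act 1%g x = x;
  actM : forall g h x, act (g * h)%g x = act g (act h x);
  act_continuous : forall g, continuous (act g) }.

(* The entourages of the unique compatible uniform structure when X is compact
   Hausdorff: the neighborhoods of the diagonal for the product topology. *)
Definition diag_entourage (X : topologicalType) : set_system (X * X) :=
  set_nbhs (@diagonal X).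

Section Dynamics.
Variables (G : groupType) (X : topologicalType) (act : G -> X -> X).
Implicit Types (U : set (X * X)) (x y : X) (f : X -> X).

Definition expansive : Prop :=
  exists2 U0 : set (X * X), diag_entourage U0 &
    forall x y, x <> y -> exists g : G, ~ U0 (act g x, act g y).

Definition weak_specification : Prop :=
  forall U, diag_entourage U -> exists Lambda : {fset G},
    forall (n : nat) (Omega : 'I_n -> {fset G}) (x_ : 'I_n -> X),
      (1 <= n)%N ->
      (forall j k, j <> k ->
        (Omega j `&` [fset (a * b)%g | a in Lambda, b in Omega k])%fset
          = fset0) ->
      exists x, forall (i : 'I_n) (g : G), g \in Omega i ->
        U (act g x, act g (x_ i)).

Definition homoclinic x y : Prop :=
  forall U, diag_entourage U -> exists Omega : {fset G},
    forall g : G, g \notin Omega -> U (act g x, act g y).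

Definition homoclinicity_class x : set X := [set y | homoclinic x y].

Definition equivariant f : Prop := forall g x, f (act g x) = act g (f x).

Definition pre_injective f : Prop :=
  forall x, set_inj (homoclinicity_class x) f.

Definition surjective f : Prop := set_surj [set: X] [set: X] f.

Definition Myhill_property : Prop :=
  forall f, continuous f -> equivariant f -> pre_injective f -> surjective f.

Definition surjunctive : Prop :=
  forall f, continuous f -> equivariant f -> injective f -> surjective f.

End Dynamics.

(* Main.v *)
(* Suppose that f is continuous, equivariant and pre-injective, and that some p
   is missed by the closed invariant set Y = f(X). Let U0 be an expansiveness
   entourage and s(F) the largest cardinality of an (F, U0)-separated subset of
   Y; adding k elements to F multiplies s(F) by at most C^k, where C is the size
   of a cover of X by U0-small sets. Let F be a Foelner set, L the symmetric
   finite set given by weak specification at a small scale, and S a maximal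
   L-separated subset of F. For A a subset of S and y in a maximal
   (F \ LA, U0)-separated subset of Y, specification gives a point x_(A,y) with
   g x_(A,y) close to p for g in A, to g y for g in F \ LA, and to g p for g
   outside LF. These points are pairwise distinct, because p is far from Y, and
   pairwise homoclinic by expansiveness; hence their images are distinct points
   of Y, and they are (LF, U0)-separated because they are close off LF. With
   c = C^|L|, counting gives
     s(F) (1 + 1/c)^|S| <= sum over A of s(F \ LA) <= s(LF)
                        <= C^|LF \ F| s(F),
   which fails once |LF \ F| is small compared with |F| <= |L| |S|. *)
Require Import Defs.
From mathcomp Require Import all_boot all_algebra finmap.
From mathcomp Require Import all_classical reals topology.

Import GRing.Theory Num.Theory numFieldNormedType.Exports.

Set Implicit Arguments.
Unset Strict Implicit.

Local Open Scope classical_set_scope.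

(** * Compactness and the uniformity of a compact Hausdorff space *)

Lemma compact_directed_closed (T : topologicalType) (I : Type) (D : set I)
    (B : I -> set T) :
  compact [set: T] -> (exists i, D i) ->
  (forall i, D i -> closed (B i)) -> (forall i, D i -> B i !=set0) ->
  (forall i j, D i -> D j -> exists2 k, D k & B k `<=` B i `&` B j) ->
  exists x, forall i, D i -> B i x.
Proof.
move=> cT D0 clB B0 dirB.
have PF := filter_from_proper (filter_from_filter D0 dirB) B0.
(* The sets [B i] generate a proper filter; a cluster point of it adheres to each [B i], hence lies
   in it. *)
have [x [_ clx]] := cT _ PF (@filterT _ _ PF).
exists x => i Di; apply: (clB i Di) => W Wx.
by apply: clx => //; exists i.
Qed.

Lemma diagonal_closed (X : topologicalType) :
  hausdorff_space X -> closed (@diagonal X).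
Proof.
move=> hX [x y] clxy; apply: hX => A B /= xA yB.
have [|[a b] [/diagonalP <- [aA aB]]] := clxy (A `*` B); last by exists a.
by exists (A, B).
Qed.

Lemma hausdorff_prod (X Y : topologicalType) :
  hausdorff_space X -> hausdorff_space Y -> hausdorff_space (X * Y)%type.
Proof.
move=> hX hY [x y] [x' y'] cl; congr pair; [apply: hX|apply: hY] => A B nA nB.
  have [||[a b] /= [Aa Ba]] := cl (fst @^-1` A) (fst @^-1` B); last by exists a.
  - by apply: (@cvg_fst _ _ (nbhs x) (nbhs y)).
  - by apply: (@cvg_fst _ _ (nbhs x') (nbhs y')).
have [||[a b] /= [Aa Ba]] := cl (snd @^-1` A) (snd @^-1` B); last by exists b.
- by apply: (@cvg_snd _ _ (nbhs x) (nbhs y)).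
- by apply: (@cvg_snd _ _ (nbhs x') (nbhs y')).
Qed.

Lemma diag_entourageI (X : topologicalType) (U V : set (X * X)) :
  diag_entourage U -> diag_entourage V -> diag_entourage (U `&` V).
Proof. exact: filterI. Qed.

Section Entourages.
Variables (X : topologicalType).
Hypotheses (cX : compact [set: X]) (hX : hausdorff_space X).

Lemma compact_prodT (Y : topologicalType) :
  compact [set: Y] -> compact [set: (X * Y)%type].
Proof. by move=> cY; rewrite -setXTT; exact: compact_setX. Qed.

Lemma diag_entourage_map (f : X -> X) (U : set (X * X)) :
  continuous f -> diag_entourage U ->
  diag_entourage [set z | U (f z.1, f z.2)].
Proof.
move=> cf entU [x y] /diagonalP <-.
have : (f z.1, f z.2) @[z --> (x, x)] --> (f x, f x).
  apply: cvg_pair.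
    by apply: (@cvg_comp _ _ _ fst f _ (nbhs x)); [exact: cvg_fst|exact: cf].
  by apply: (@cvg_comp _ _ _ snd f _ (nbhs x)); [exact: cvg_snd|exact: cf].
by apply; exact: entU.
Qed.

Lemma diag_entourage_swap (U : set (X * X)) :
  diag_entourage U -> diag_entourage [set z | U (z.2, z.1)].
Proof.
move=> entU [x y] /diagonalP <-.
have : (z.2, z.1) @[z --> (x, x)] --> (x, x).
  apply: cvg_pair.
    exact: (@cvg_snd _ _ (nbhs x) (nbhs x)).
  exact: (@cvg_fst _ _ (nbhs x) (nbhs x)).
by apply; exact: entU.
Qed.

Lemma diag_entourage_closed (U : set (X * X)) : diag_entourage U ->
  exists V, [/\ diag_entourage V, closed V & V `<=` U].
Proof.
have nXX : normal_space (X * X)%type.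
  apply: compact_normal; first exact: hausdorff_prod.
  exact: compact_prodT.
move=> /(nXX _ (diagonal_closed hX)) [V entV clVU]; exists (closure V).
split => //; last exact: closed_closure.
exact: (filterS (@subset_closure _ V) entV).
Qed.

Lemma diag_entourage_sep (x y : X) : x <> y ->
  exists2 V, diag_entourage V & ~ V (x, y).
Proof.
move=> xy; exists (~` [set (x, y)]) => [[a b] /diagonalP <-|]; last exact.
apply: open_nbhs_nbhs; split; last by move=> [ax ay]; apply: xy; rewrite -ax.
apply: closed_openC; apply: accessible_closed_set1.
by apply: hausdorff_accessible; exact: hausdorff_prod.
Qed.

(** If every closed entourage [V] failed, the triples witnessing the failures would form a directed
    family of nonempty closed subsets of the cube of [X]. A common triple lies in every closed
    entourage, so its entries coincide, against its being outside the interior of [U]. Taking the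
    interior is what makes these sets closed. *)
Lemma diag_entourage_split (U : set (X * X)) : diag_entourage U ->
  exists V, [/\ diag_entourage V, closed V, forall x y, V (x, y) -> V (y, x) &
    forall x y z, V (x, y) -> V (y, z) -> U (x, z)].
Proof.
move=> entU.
pose D := [set V : set (X * X) | diag_entourage V /\ closed V].
pose B (V : set (X * X)) := [set t : X * (X * X) |
  [/\ V (t.1, t.2.1), V (t.2.1, t.2.2) & ~ U° (t.1, t.2.2)]].
have cont13 : continuous (fun t : X * (X * X) => (t.1, t.2.2)).
  move=> t; apply: cvg_pair; first exact: cvg_fst.
  by apply: (@cvg_comp _ _ _ snd snd _ (nbhs t.2)); exact: cvg_snd.
have cont12 : continuous (fun t : X * (X * X) => (t.1, t.2.1)).
  move=> t; apply: cvg_pair; first exact: cvg_fst.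
  apply: (@cvg_comp _ _ _ snd fst _ (nbhs t.2)); first exact: cvg_snd.
  exact: cvg_fst.
have cont23 : continuous (fun t : X * (X * X) => (t.2.1, t.2.2)).
  move=> t; apply: cvg_pair.
    apply: (@cvg_comp _ _ _ snd fst _ (nbhs t.2)); first exact: cvg_snd.
    exact: cvg_fst.
  by apply: (@cvg_comp _ _ _ snd snd _ (nbhs t.2)); exact: cvg_snd.
have [[V [[entV clV] BV0]]|noV] :=
    pselect (exists V, D V /\ ~ (B V !=set0)); last first.
  have [] := @compact_directed_closed _ _ D B.
  - by apply: compact_prodT; apply: compact_prodT.
  - by exists setT; split; [exact: filterT|exact: closedT].
  - move=> V [_ clV].
    rewrite (_ : B V = (fun t : X * (X * X) => (t.1, t.2.1)) @^-1` V `&`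
      ((fun t : X * (X * X) => (t.2.1, t.2.2)) @^-1` V `&`
       (fun t : X * (X * X) => (t.1, t.2.2)) @^-1` (~` U°))).
      have /continuous_closedP k12 := cont12.
      have /continuous_closedP k23 := cont23.
      have /continuous_closedP k13 := cont13.
      apply: closedI; first exact: k12.
      apply: closedI; first exact: k23.
      by apply: k13; apply: open_closedC; exact: open_interior.
    by apply/seteqP; split => t; [case=> a b c; split|case=> a [b c]; split].
  - by move=> V DV; apply: contrapT => BV; apply: noV; exists V.
  - move=> V W [entV clV] [entW clW]; exists (V `&` W).
      by split; [exact: diag_entourageI|exact: closedI].
    by move=> t [[? ?] [? ?] ?]; split.
  move=> [x [y z]] Bxyz.
  have eqV a b : (forall V, D V -> V (a, b)) -> a = b.
    move=> abV; apply: contrapT => /diag_entourage_sep [V entV]; apply.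
    have [W [entW clW WV]] := diag_entourage_closed entV.
    by apply: WV; apply: abV; split.
  have exy : x = y by apply: eqV => V /Bxyz [].
  have eyz : y = z by apply: eqV => V /Bxyz [].
  have DT : D setT by split; [exact: filterT|exact: closedT].
  have [_ _ /= []] := Bxyz setT DT.
  by rewrite exy eyz; exact: (entU (z, z)).
(* Symmetrizing only shrinks [V], so the composition property survives. *)
exists (V `&` [set z | V (z.2, z.1)]); split.
- by apply: diag_entourageI => //; exact: diag_entourage_swap.
- apply: closedI => //.
  have /continuous_closedP : continuous (fun z : X * X => (z.2, z.1)).
    by move=> z; apply: cvg_pair; [exact: cvg_snd|exact: cvg_fst].
  exact.
- by move=> x y [].
move=> x y z [Vxy _] [Vyz _]; apply: interior_subset; apply: contrapT => Uxz.
by apply: BV0; exists (x, (y, z)).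
Qed.

End Entourages.

(** * Counting by fibres and growth of powers *)

Lemma card_fset_fibres (T K : choiceType) (Z : {fset T}) (E : {fset K})
    (t : T -> K) : (forall z, z \in Z -> t z \in E) ->
  #|` Z| = (\sum_(e <- E) #|` [fset z in Z | t z == e]|%fset)%N.
Proof.
move=> tE.
transitivity (\sum_(e <- E) \sum_(z <- Z) (t z == e))%N; last first.
  apply: eq_bigr => e _; rewrite card_fset_sum1 big_fset /=.
  by rewrite [RHS]big_mkcond.
rewrite exchange_big card_fset_sum1 [LHS]big_seq [RHS]big_seq.
apply: eq_bigr => z /tE tzE; rewrite (big_fsetD1 (t z)) //= eqxx big_seq.
rewrite big1 // => e; rewrite !inE => /andP[eN _].
by rewrite eq_sym (negbTE eN).
Qed.

Lemma exists_expn_gt (C c : nat) : (0 < c)%N ->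
  exists M, (C * c ^ M < c.+1 ^ M)%N.
Proof.
move=> c0.
(* Bernoulli's inequality 1 + m/c <= (1 + 1/c)^m without denominators. At m = C c the left side is 1
   + C. *)
have H m : ((c + m) * c ^ m <= c * c.+1 ^ m)%N.
  elim: m => [|m IH]; first by rewrite addn0.
  rewrite !expnS mulnCA [leqRHS]mulnCA.
  apply: leq_trans (leq_mul (leqnn _) IH); rewrite !mulnA.
  by rewrite leq_mul2r addnS mulnS mulSn leq_add2r leq_addr orbT.
exists (C * c)%N; have := H (C * c)%N.
rewrite -{1}[c]mul1n -mulnDl mulnAC mulnC leq_mul2l add1n.
rewrite eqn0Ngt c0 /=; apply: leq_trans.
by rewrite ltn_mul2r ltnSn expn_gt0 c0.
Qed.

(** * Products of finite sets and Foelner sets *)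

Section Foelner.
Variables (R : realType) (G : groupType).
Local Open Scope fset_scope.

Definition fset_mulg (A B : {fset G}) : {fset G} :=
  [fset (a * b)%g | a in A, b in B].

Lemma fset_mulgP (A B : {fset G}) (g : G) :
  reflect (exists a b, [/\ a \in A, b \in B & g = (a * b)%g])
    (g \in fset_mulg A B).
Proof.
apply: (iffP (imfset2P _ _ _ _ _)) => [[a Aa [b Bb ->]]|[a [b [Aa Bb ->]]]].
  by exists a, b.
by exists a => //; exists b.
Qed.

Lemma mem_fset_mulg (A B : {fset G}) a b :
  a \in A -> b \in B -> (a * b)%g \in fset_mulg A B.
Proof. by move=> Aa Bb; apply/fset_mulgP; exists a, b. Qed.

Lemma card_fset_mulg (A B : {fset G}) :
  (#|` fset_mulg A B| <= #|` A| * #|` B|)%N.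
Proof.
have -> : fset_mulg A B = [fset g in [seq (a * b)%g | a <- A, b <- B]].
  apply/fsetP => g; rewrite inE /=; apply/fset_mulgP/allpairsP.
    by move=> [a [b [Aa Bb ->]]]; exists (a, b).
  by move=> [[a b] [Aa Bb ->]]; exists a, b.
by rewrite card_fseq -(size_allpairs (fun a b => a * b)%g) size_undup.
Qed.

(** The set LF \ F is covered by the differences gF \ F with g in [L]. With N = k |L|, each of them
    satisfies N |gF \ F| <= |F| far out in the net, and summing over [L] costs a factor |L|. *)
Lemma amenable_foelner (L : {fset G}) (k : nat) : amenable R G ->
  exists F : {fset G}, F != fset0 /\
    (k * #|` fset_mulg L F `\` F| <= #|` F|)%N.
Proof.
move=> [J [le [F [[[j0 _] lexx letr leub] F0 Fcvg]]]].
have FF : Filter (net_tails le).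
  apply: filter_from_filter; first by exists j0.
  move=> i j _ _; have [l [il jl]] := leub i j; exists l => // h lh.
  by split; [exact: letr lh|exact: letr lh].
pose N := (k * #|` L|)%N.
have small g : \forall j \near net_tails le,
    (N * #|` [fset (g * h)%g | h in F j] `\` F j| <= #|` F j|)%N.
  (* The threshold 1/(N+1) is also meaningful when N = 0. *)
  have e0 : (0 < N.+1%:R^-1 :> R)%R by rewrite invr_gt0 ltr0n.
  have /cvgrPdist_lt /(_ _ e0) := Fcvg g.
  apply: filterS => j; rewrite sub0r normrN ger0_norm ?divr_ge0 //.
  have Fj0 : (0 < #|` F j|)%N by rewrite cardfs_gt0; apply/eqP.
  rewrite ltr_pdivrMr ?ltr0n // mulrC ltr_pdivlMr ?ltr0n //.
  rewrite -natrM ltr_nat => lt; apply: leq_trans (ltnW lt).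
  by rewrite mulnC leq_mul.
have /(_ (enum_fset L)) : forall s : seq G,
    \forall j \near net_tails le, forall g, g \in s ->
    (N * #|` [fset (g * h)%g | h in F j] `\` F j| <= #|` F j|)%N.
  elim=> [|g s IH]; first by apply: nearW => j g; rewrite in_nil.
  near=> j => h; rewrite inE => /predU1P[->|hs].
    by near: j; exact: small.
  by move: h hs; near: j.
move=> [j _ /(_ j (lexx j)) Fj]; exists (F j); split; first exact/eqP.
(* The empty [L] is set apart because |L| is cancelled below. *)
have [L0|L0] := posnP #|` L|.
  rewrite (_ : fset_mulg L (F j) `\` F j = fset0) ?cardfs0 ?muln0 //.
  apply/fsetP => g; rewrite !inE; apply/negbTE/nandP; right.
  apply/negP => /fset_mulgP[a [b []]].
  by rewrite (cardfs0_eq L0) inE.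
(* [t] picks a translate gF containing each point of LF, with an arbitrary value elsewhere; its
   fibre over g in LF \ F lies in gF \ F. *)
have /choice[t tP] (z : G) : exists g, z \in fset_mulg L (F j) ->
    g \in L /\ z \in [fset (g * h)%g | h in F j].
  have [/fset_mulgP[a [b [La Fb ->]]]|] := boolP (z \in _); last by exists 1%g.
  by exists a => _; split => //; apply/imfsetP; exists b.
rewrite (@card_fset_fibres _ _ _ L t); last first.
  by move=> z; rewrite !inE => /andP[_ /tP[]].
rewrite -(leq_pmul2l L0) mulnA [(_ * k)%N]mulnC -/N big_distrr /=.
apply: (@leq_trans (\sum_(g <- L) #|` F j|)); last first.
  by rewrite big_const_seq count_predT iter_addn_0 mulnC.
rewrite big_seq [leqRHS]big_seq; apply: leq_sum => g Lg.
apply: leq_trans (Fj _ Lg); rewrite leq_mul2l fsubset_leq_card ?orbT //.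
apply/fsubsetP => z; rewrite !inE -!andbA => /and3P[zF zLF /eqP tz].
by rewrite zF /=; have [] := tP _ zLF; rewrite tz.
Unshelve. all: by end_near.
Qed.

End Foelner.

(** * Homoclinic points and specification *)

Section Dynamics.
Variables (G : groupType) (X : topologicalType) (act : G -> X -> X).
Hypotheses (cX : compact [set: X]) (hX : hausdorff_space X).
Hypothesis ca : continuous_action act.
Implicit Types (U V : set (X * X)) (F : {fset G}) (Z : {fset X}) (Y : set X).

(** A pair that stays [V]-close along all of [G] is diagonal by expansiveness. By compactness,
    closeness along some finite [D] already forces the pair into [W]. *)
Lemma homoclinic_of_close U V (Omega : {fset G}) x y :
  (forall a b, a <> b -> exists g, ~ U (act g a, act g b)) ->
  closed V -> V `<=` U ->
  (forall g, g \notin Omega -> V (act g x, act g y)) -> homoclinic act x y.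
Proof.
move=> Uexp clV VU Vxy W entW.
pose B (D : {fset G}) := [set z : X * X |
  ~ W° z /\ forall g, g \in D -> V (act g z.1, act g z.2)].
have [[D BD0]|noD] := pselect (exists D, ~ (B D !=set0)).
  (* For g outside D^-1 Omega, the set Dg misses [Omega], so closeness holds along [D] for the pair
     translated by g. *)
  exists (fset_mulg [fset d^-1%g | d in D]%fset Omega) => g gN.
  apply: interior_subset; apply: contrapT => Wg; apply: BD0.
  exists (act g x, act g y); split => // d dD /=.
  rewrite -!(actM ca); apply: Vxy; apply: contra gN => dgO.
  apply/fset_mulgP; exists d^-1%g, (d * g)%g; rewrite mulKg; split => //.
  by apply/imfsetP; exists d.
have [] := @compact_directed_closed _ _ [set: {fset G}] B.
- exact: compact_prodT.
- by exists fset0.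
- move=> D _.
  rewrite (_ : B D = ~` W° `&` \bigcap_(g in [set` D])
      ((fun z : X * X => (act g z.1, act g z.2)) @^-1` V)).
    apply: closedI; first by apply: open_closedC; exact: open_interior.
    apply: closed_bigI => g _.
    have /continuous_closedP : continuous
        (fun z : X * X => (act g z.1, act g z.2)); last exact.
    move=> z; apply: cvg_pair.
      apply: (@cvg_comp _ _ _ fst (act g) _ (nbhs z.1)); first exact: cvg_fst.
      exact: act_continuous.
    apply: (@cvg_comp _ _ _ snd (act g) _ (nbhs z.2)); first exact: cvg_snd.
    exact: act_continuous.
  by apply/seteqP; split => z [? ?].
- by move=> D _; apply: contrapT => BD; apply: noD; exists D.
- move=> D E _ _; exists (D `|` E)%fset => // z [Wz DEz].
  by split; split => // g gD; apply: DEz; rewrite inE gD ?orbT.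
move=> [a b] Bab.
have [ab|/Uexp [g]] := pselect (a = b); last first.
  case; apply: VU; have [_] := Bab [fset g]%fset I.
  by apply; rewrite inE.
by have [[]] := Bab fset0 I; rewrite ab; exact: (entW (b, b)).
Qed.

(** Enlarging the specification set to a symmetric one containing 1 turns disjointness from
    translates into a condition on quotients. The index [t0] ensures that there is at least one
    block. *)
Lemma weak_specification_fin U : weak_specification act -> diag_entourage U ->
  exists L : {fset G}, [/\ (1%g \in L), forall g, g \in L -> (g^-1)%g \in L &
    forall (T : finType) (Omega : T -> {fset G}) (x_ : T -> X) (t0 : T),
      (forall j k g h, j != k -> g \in Omega j -> h \in Omega k ->
        (g * h^-1)%g \notin L) ->
      exists x, forall t g, g \in Omega t -> U (act g x, act g (x_ t))].
Proof.
move=> wsp /wsp[L0 HL0].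
exists (1%g |` (L0 `|` [fset g^-1%g | g in L0]))%fset; split.
- by rewrite !inE eqxx.
- move=> g; rewrite !inE => /or3P[/eqP->|gL|/imfsetP[h /= hL ->]].
  + by rewrite invg1 eqxx.
  + by apply/or3P/Or33/imfsetP; exists g.
  + by rewrite invgK hL orbT.
move=> T Omega x_ t0 sepO.
have [|j k jk|x xP] := HL0 #|T| (Omega \o enum_val) (x_ \o enum_val).
- by apply/card_gt0P; exists t0.
- apply/fsetP => g; rewrite in_fset0; apply/negbTE/negP.
  rewrite inE => /andP[gj /imfset2P[a /= aL [b bk gE]]].
  have := sepO _ _ g b _ gj bk; rewrite gE mulgK !inE aL orbT => H.
  by apply/notF/H; apply/negP => /eqP/enum_val_inj.
by exists x => t g gO; have := xP (enum_rank t) g; rewrite /= enum_rankK; exact.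
Qed.

(** Specification traces finite blocks only. As [U] is closed, compactness lets the last block grow
    to the whole complement of LF. *)
Lemma weak_specification_extend U : weak_specification act ->
  diag_entourage U -> closed U ->
  exists L : {fset G}, [/\ (1%g \in L), forall g, g \in L -> (g^-1)%g \in L &
    forall (A B F : {fset G}) (u : G -> X) (y z : X),
      (forall a a', a \in A -> a' \in A -> a != a' -> (a * a'^-1)%g \notin L) ->
      (forall b a, b \in B -> a \in A -> (b * a^-1)%g \notin L) ->
      {subset A <= F} -> {subset B <= F} ->
      exists x, [/\ forall a, a \in A -> U (act a x, act a (u a)),
        forall b, b \in B -> U (act b x, act b y) &
        forall g, g \notin fset_mulg L F -> U (act g x, act g z)]].
Proof.
move=> wsp entU clU; have [L [L1 LV HL]] := weak_specification_fin wsp entU.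
exists L; split => // A B F u y z sepA sepBA AF BF.
pose C (E : {fset G}) := [set x |
  [/\ forall a, a \in A -> U (act a x, act a (u a)),
      forall b, b \in B -> U (act b x, act b y) &
      forall g, g \in (E `\` fset_mulg L F)%fset -> U (act g x, act g z)]].
have [] := @compact_directed_closed _ _ [set: {fset G}] C cX.
- by exists fset0.
- move=> E _.
  pose D g (c : X) := ((fun x : X => (act g x, c)) @^-1` U).
  have clD g c : closed (D g c).
    have /continuous_closedP : continuous (fun x : X => (act g x, c));
      last exact.
    move=> x; apply: cvg_pair; first exact: act_continuous.
    exact: cvg_cst.
  rewrite (_ : C E = \bigcap_(a in [set` A]) D a (act a (u a)) `&`
    (\bigcap_(b in [set` B]) D b (act b y) `&`
     \bigcap_(g in [set` (E `\` fset_mulg L F)%fset]) D g (act g z))).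
    by apply: closedI; [|apply: closedI]; apply: closed_bigI => g _.
  by apply/seteqP; split => x; [case=> a b c; split|case=> a [b c]; split].
- move=> E _.
  (* Each point of [A] is a block of its own, so that its target may depend on it. *)
  pose Omega (t : option (option A)) : {fset G} :=
    match t with
    | Some (Some a) => [fset val a]
    | Some None => B
    | None => E `\` fset_mulg L F
    end%fset.
  pose x_ (t : option (option A)) := match t with
    | Some (Some a) => u (val a) | Some None => y | None => z end.
  have symL g h : (g * h^-1)%g \notin L -> (h * g^-1)%g \notin L.
    by apply: contra => /LV; rewrite invgF.
  have farF g h : h \in F -> g \in (E `\` fset_mulg L F)%fset ->
      (g * h^-1)%g \notin L.
    move=> hF; rewrite inE => /andP[gN _]; apply: contra gN => gh.
    by apply/fset_mulgP; exists (g * h^-1)%g, h; rewrite mulgVK.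
  have [|x xP] := HL _ Omega x_ None.
    move=> [[a|]|] [[a'|]|] g h //= jk.
    + move=> /fset1P-> /fset1P->; apply: sepA; try exact: valP.
      by apply: contra jk => /eqP/val_inj->.
    + by move=> /fset1P-> hB; apply/symL/sepBA => //; exact: valP.
    + by move=> /fset1P-> hE; apply/symL/farF => //; apply: AF; exact: valP.
    + by move=> gB /fset1P->; apply/sepBA => //; exact: valP.
    + by move=> /BF gF hE; apply/symL/farF.
    + by move=> gE /fset1P->; apply/farF => //; apply: AF; exact: valP.
    + by move=> gE /BF hF; exact/farF.
  exists x; split.
  + move=> a aA; apply: (xP (Some (Some [` aA]%fset))); rewrite /= inE.
    exact: eqxx.
  + by move=> b bB; exact: (xP (Some None)).
  + by move=> g gE; exact: (xP None).
- move=> E E' _ _; exists (E `|` E')%fset => // x [xA xB xE].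
  by split; split => // g; rewrite inE => /andP[gF gE]; apply: xE;
    rewrite 2!inE gF gE ?orbT.
move=> x xP; exists x; split.
- by have [] := xP fset0 I.
- by have [] := xP fset0 I.
move=> g gN; have [_ _] := xP [fset g]%fset I.
by apply; rewrite !inE gN /=.
Qed.

(** * Cardinalities of separated sets *)

Lemma finite_small_cover U : diag_entourage U ->
  exists (E : {fset X}) (t : X -> X),
  (forall x, t x \in E) /\ forall x y, t x = t y -> U (x, y).
Proof.
move=> /(diag_entourage_split cX hX)[V [entV clV symV splitV]].
(* Were no finite [E] enough, compactness would give a point x with (x, x) outside the interior of
   [V]. Otherwise [t] labels each point by a [V]-close element of [E], and equal labels mean
   [U]-closeness. *)
pose B (E : {fset X}) := [set y | forall x, x \in E -> ~ V° (x, y)].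
have [[E BE0]|noE] := pselect (exists E, ~ (B E !=set0)).
  have /choice[t tP] y : exists x, x \in E /\ V (x, y).
    apply: contrapT => yN; apply: BE0; exists y => x xE /interior_subset Vxy.
    by apply: yN; exists x.
  exists E, t; split=> [x|x y txy]; first by have [] := tP x.
  have [_ /symV Vx] := tP x; apply: splitV Vx _.
  by rewrite txy; have [] := tP y.
have [] := @compact_directed_closed _ _ [set: {fset X}] B cX.
- by exists fset0.
- move=> E _.
  rewrite (_ : B E = \bigcap_(x in [set` E])
    ((fun y => (x, y)) @^-1` (~` V°))) //.
  apply: closed_bigI => x _.
  have /continuous_closedP : continuous (fun y : X => (x, y)).
    by move=> y; apply: cvg_pair; [exact: cvg_cst|exact: cvg_id].
  by apply; apply: open_closedC; exact: open_interior.
- by move=> E _; apply: contrapT => BE; apply: noE; exists E.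
- move=> E E' _ _; exists (E `|` E')%fset => // x xE.
  by split => y yE; apply: xE; rewrite inE yE ?orbT.
move=> x xP; have [] := xP [fset x]%fset I x; first by rewrite inE.
exact: (entV (x, x)).
Qed.

Definition orbit_separated U F Z : Prop :=
  forall x y, x \in Z -> y \in Z -> x <> y ->
  exists2 g, g \in F & ~ U (act g x, act g y).

(** This expresses s(F) <= n without presupposing that the maximum s(F) exists. *)
Definition sep_bound U Y F (n : nat) : Prop := forall Z,
  (forall z, z \in Z -> Y z) -> orbit_separated U F Z -> (#|` Z| <= n)%N.

Lemma sep_bound_sub U Y F F' n : {subset F <= F'} ->
  sep_bound U Y F' n -> sep_bound U Y F n.
Proof.
move=> FF' bF' Z ZY sepZ; apply: bF' => // x y xZ yZ.
by move=> /(sepZ _ _ xZ yZ)[g /FF' gF' Ug]; exists g.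
Qed.

Lemma sep_bound0 U Y : sep_bound U Y fset0 1.
Proof.
move=> Z _ sepZ; have [->|[x xZ]] := fset_0Vmem Z; first by rewrite cardfs0.
rewrite -(cardfs1 x); apply/fsubset_leq_card/fsubsetP => y yZ; rewrite inE.
by apply/eqP; apply: contrapT => /(sepZ _ _ yZ xZ)[g]; rewrite inE.
Qed.

Lemma sep_boundU U : diag_entourage U -> exists2 C, (0 < C)%N &
  forall Y F F' n, sep_bound U Y F n ->
    sep_bound U Y (F' `|` F)%fset (C ^ #|` F'| * n).
Proof.
(* The successor keeps the constant positive even if [X] is empty. *)
move=> /finite_small_cover[E [t [tE tU]]]; exists #|` E|.+1 => // Y F F' n bF.
elim/fset1U_rect: F' => [|g F' gN IH].
  by rewrite fset0U cardfs0 mul1n.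
rewrite -fsetUA cardfsU1 gN expnS -mulnA => Z ZY sepZ.
(* Points with the same label [t (act g x)] are not separated at time [g]. *)
rewrite (@card_fset_fibres _ _ _ E (t \o act g)) => [|z _]; last exact: tE.
apply: leq_trans (leq_mul (leqnSn _) (leqnn _)).
rewrite mulnC -iter_addn_0 -(count_predT (enum_fset E)) -big_const_seq.
apply: leq_sum => e _; apply: IH => [z|x y].
  by rewrite !inE => /andP[/ZY].
rewrite !inE /= => /andP[xZ /eqP tx] /andP[yZ /eqP ty].
move=> /(sepZ _ _ xZ yZ)[h /fset1UP[->|hF] Uh]; last by exists h.
by case: Uh; apply: tU; rewrite tx ty.
Qed.

Lemma sep_max U Y F : diag_entourage U -> exists Z,
  [/\ forall z, z \in Z -> Y z, orbit_separated U F Z & sep_bound U Y F #|` Z|].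
Proof.
move=> /sep_boundU[C _ bC].
pose P n := `[< exists Z, [/\ forall z, z \in Z -> Y z, orbit_separated U F Z &
  #|` Z| = n] >].
have P0 : exists n, P n.
  exists 0%N; apply/asboolP; exists fset0.
  by split=> [z|x y|]; rewrite ?cardfs0 ?inE.
(* Building [F] up from the empty set, where s = 1 is a bound, shows that the sizes are bounded. *)
have PC n : P n -> (n <= C ^ #|` F| * 1)%N.
  move=> /asboolP[Z [ZY sepZ <-]]; have := bC Y fset0 F 1%N (@sep_bound0 U Y).
  by rewrite fsetU0; exact.
case: (ex_maxnP P0 PC) => n /asboolP[Z [ZY sepZ <-]] maxn.
exists Z; split => // Z' ZY' sepZ'; apply: maxn; apply/asboolP.
by exists Z'.
Qed.

End Dynamics.

(** * Numerical inequalities and separated nets in the group *)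

Lemma expn_gap (C c M d s : nat) : (0 < s)%N -> (M * d <= s)%N ->
  (C * c ^ M < c.+1 ^ M)%N -> (C ^ d * c ^ s < c.+1 ^ s)%N.
Proof.
move=> s0 Mds CM; have [->|d0] := posnP d.
  by rewrite mul1n ltn_exp2r.
rewrite -(subnKC Mds) !expnD mulnA.
(* This is the hypothesis on [M] raised to the power [d]; strictness needs d > 0. The other s - Md
   factors only favour c + 1. *)
have lt : (C ^ d * c ^ (M * d) < c.+1 ^ (M * d))%N.
  by rewrite !expnM -expnMn ltn_exp2r.
apply: (@leq_ltn_trans (C ^ d * c ^ (M * d) * c.+1 ^ (s - M * d))).
  rewrite leq_mul2l; apply/orP; right.
  by case: (s - _)%N => [|r] //; rewrite leq_exp2r.
by rewrite ltn_pmul2r ?expn_gt0.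
Qed.

(** Expand the product of |T| factors 1 + c, with [A] recording the factors that contribute 1. *)
Lemma sum_expn_setC (T : finType) (c : nat) :
  (\sum_(A : {set T}) c ^ #|~: A|)%N = (c.+1 ^ #|T|)%N.
Proof.
rewrite -[RHS]prod_nat_const -add1n (eq_bigl xpredT) //.
rewrite (@bigA_distr _ 0 1 muln addn T (fun=> 1) (fun=> c))%N.
apply: eq_big => // A _; rewrite -prod_nat_const [RHS]big_mkcond /=.
rewrite big_mkcond /=; apply: eq_bigr => i _.
by rewrite inE; case: (i \in A).
Qed.

(** Greedy choice: a new element either lies in LS already or can be added to [S]. Hence F is
    contained in LS. *)
Lemma fset_net (G : groupType) (L F : {fset G}) :
  (1%g \in L) -> (forall g, g \in L -> (g^-1)%g \in L) ->
  exists S : {fset G}, [/\ {subset S <= F},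
    forall a b, a \in S -> b \in S -> a != b -> (a * b^-1)%g \notin L &
    (#|` F| <= #|` L| * #|` S|)%N].
Proof.
move=> L1 LV.
suff [S [SF sepS FS]] : exists S : {fset G}, [/\ {subset S <= F},
    forall a b, a \in S -> b \in S -> a != b -> (a * b^-1)%g \notin L &
    {subset F <= fset_mulg L S}].
  exists S; split => //; apply: leq_trans (card_fset_mulg L S).
  exact/fsubset_leq_card/fsubsetP.
elim/fset1U_rect: F => [|g F gN [S [SF sepS FS]]].
  by exists fset0; split => // a; rewrite inE.
have [gS|gS] := boolP (g \in fset_mulg L S).
  exists S; split => // a; first by move=> /SF aF; rewrite fset1Ur.
  by move=> /fset1UP[->//|/FS].
have gL a : a \in S -> (g * a^-1)%g \notin L.
  move=> aS; apply: contra gS => gaL; apply/fset_mulgP.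
  by exists (g * a^-1)%g, a; rewrite mulgVK.
exists (g |` S)%fset; split.
- by move=> a /fset1UP[->|/SF aF]; [exact: fset1U1|rewrite fset1Ur].
- move=> a b /fset1UP[->|aS] /fset1UP[->|bS]; rewrite ?eqxx //.
  + by move=> _; exact: gL.
  + move=> _; apply: contra (gL _ aS) => /LV.
    by rewrite invgF.
  + exact: sepS.
move=> a /fset1UP[->|/FS /fset_mulgP[b [s [bL sS ->]]]].
  by apply/fset_mulgP; exists 1%g, g; rewrite mul1g fset1U1.
by rewrite mem_fset_mulg // fset1Ur.
Qed.

(** * The counting argument for the Myhill property *)

Section MyhillProperty.
Variables (G : groupType) (X : topologicalType) (act : G -> X -> X).
Hypotheses (cX : compact [set: X]) (hX : hausdorff_space X).
Hypothesis ca : continuous_action act.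

(** Since [range f] is compact and misses [p], the complement of {p} x f(X) is an open neighborhood
    of the diagonal. A single closed [U] then serves expansiveness before and after [f], and keeps
    [p] away from the image. *)
Lemma equivariant_diag_entourage (U0 : set (X * X)) (f : X -> X) p :
  diag_entourage U0 -> continuous f -> ~ range f p ->
  exists2 U, diag_entourage U /\ closed U &
    forall x y, U (x, y) ->
      [/\ U0 (x, y), U0 (f x, f y) & ~ (x = p /\ range f y)].
Proof.
move=> entU0 cf pN.
have clY : closed ([set p] `*` range f).
  apply: compact_closed; first exact: hausdorff_prod.
  apply: compact_setX; first exact: compact_set1.
  by apply: continuous_compact cX; exact: continuous_subspaceT.
have entW : diag_entourage (~` ([set p] `*` range f)).
  move=> [x y] /diagonalP <-; apply: open_nbhs_nbhs; split.
    exact: closed_openC.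
  by move=> [/= ->].
have [U [entU clU UU]] := diag_entourage_closed cX hX (diag_entourageI
  (diag_entourageI entU0 (diag_entourage_map cf entU0)) entW).
by exists U => // x y /UU[[? ?] ?]; split.
Qed.

Lemma pre_injective_surjective (R : realType) (f : X -> X) :
  amenable R G -> expansive act -> weak_specification act ->
  continuous f -> equivariant act f -> pre_injective act f -> surjective f.
Proof.
move=> amG [U0 entU0 expU0] wsp cf eqf injf.
suff Yp p : range f p by move=> p _; have [q _ <-] := Yp p; exists q.
apply: contrapT => pN.
have Yact g y : range f y -> range f (act g y).
  by move=> [x _ <-]; exists (act g x) => //; rewrite eqf.
have [U [entU clU UP]] := equivariant_diag_entourage entU0 cf pN.
have [V [entV clV symV VVU]] := diag_entourage_split cX hX entU.
have [L [L1 LV HL]] := weak_specification_extend cX ca wsp entV clV.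
have [C C0 boundU] := sep_boundU act cX hX entU0.
pose c := (C ^ #|` L|)%N.
have c0 : (0 < c)%N by rewrite expn_gt0 C0.
have [M CM] := exists_expn_gt C c0.
(* The factor M |L| yields M |LF \ F| <= |F| / |L| <= |S|, as [expn_gap] requires. *)
have [F [F0 foelF]] := amenable_foelner L (M * #|` L|) amG.
have [S [SF sepS FS]] := fset_net F L1 LV.
have L0 : (0 < #|` L|)%N by rewrite cardfs_gt0; apply/fset0Pn; exists 1%g.
have S0 : (0 < #|` S|)%N.
  move: F0; rewrite -cardfs_gt0 => /leq_trans/(_ FS).
  by rewrite muln_gt0 => /andP[].
pose d := #|` fset_mulg L F `\` F|%fset.
have MdS : (M * d <= #|` S|)%N.
  by rewrite -(leq_pmul2l L0) mulnA [(_ * M)%N]mulnC; exact: leq_trans FS.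
pose B (A : {set S}) :=
  [fset g in F | [forall a in A, (g * (val a)^-1)%g \notin L]]%fset.
have BP (A : {set S}) g : reflect
    (g \in F /\ forall a, a \in A -> (g * (val a)^-1)%g \notin L) (g \in B A).
  rewrite !inE; apply: (iffP andP) => [[gF /forall_inP]|[gF H]]; first by split.
  by split => //; apply/forall_inP.
have /choice[Z ZP] (A : {set S}) := sep_max act cX hX (range f) (B A) entU0.
have ZY A z : z \in Z A -> range f z by have [+ _ _] := ZP A; apply.
pose T := {A : {set S} & Z A}.
have /choice[x xP] (t : T) : exists x,
    [/\ forall a : S, a \in tag t -> V (act (val a) x, p),
        forall g, g \in B (tag t) -> V (act g x, act g (val (tagged t))) &
        forall g, g \notin fset_mulg L F -> V (act g x, act g p)].
  (* The target a^-1 p is chosen so that its translate by a is [p]. *)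
  have [|b a|a|b|x [xA xB xF]] := HL
    [fset val a | a in tag t]%fset (B (tag t)) F
    (fun a => act a^-1%g p) (val (tagged t)) p.
  - move=> a a' /imfsetP[{}a /= aA ->] /imfsetP[{}a' /= aA' ->].
    by apply: sepS; exact: valP.
  - by move=> /BP[_ bP] /imfsetP[{}a /= aA ->]; exact: bP.
  - by move=> /imfsetP[{}a /= aA ->]; apply: SF; exact: valP.
  - by move=> /BP[].
  exists x; split => // a aA.
  have := xA (val a); rewrite -(actM ca) mulgV (act1 ca); apply.
  by apply/imfsetP; exists a.
have VU y z w : V (y, z) -> V (y, w) -> U (z, w).
  by move=> /symV yz yw; exact: VVU yw.
(* If a belongs to the first set only, then separation of [S] puts it in F \ LA'. The common point
   would then be moved by a close to both [p] and a point of f(X). *)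
have subA t t' : x t = x t' -> tag t \subset tag t'.
  move=> xtt; apply/fintype.subsetP => a aA; apply: contraT => aN.
  have [tA _ _] := xP t; have [_ tB _] := xP t'.
  have aB : val a \in B (tag t').
    apply/BP; split=> [|a' aA']; first by apply: SF; exact: valP.
    apply: sepS; [exact: valP|exact: valP|].
    by apply: contraNneq aN => /val_inj->.
  have := tB _ aB; rewrite -xtt => /(VU _ _ _ (tA _ aA)) /UP[_ _ []].
  by split => //; apply: Yact; apply: ZY; exact: valP.
have x_inj : injective x.
  move=> t t' xtt.
  have tagE : tag t = tag t'.
    by apply/eqP; rewrite finset.eqEsubset !subA.
  have [_ tB _] := xP t; have [_ tB' _] := xP t'.
  move: t t' xtt tagE tB tB' => [A y] [A' y'] /= xtt AA'.
  move: y y' xtt; rewrite -AA' => y y' xtt tB tB'; congr existT.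
  apply: val_inj; apply: contrapT.
  (* Distinct y, y' would be separated at some g in F \ LA, yet both are traced there by the same
     point. *)
  have [_ sepZ _] := ZP A => /(sepZ _ _ (valP y) (valP y')) [g gB] [].
  have := tB' _ gB; rewrite -xtt => /(VU _ _ _ (tB _ gB)).
  by move=> /UP[].
have xU t t' g : g \notin fset_mulg L F -> U (act g (x t), act g (x t')).
  move=> gN; have [_ _ /(_ g gN) h] := xP t; have [_ _ /(_ g gN) h'] := xP t'.
  by apply: VVU h _; exact: symV.
have x_homo t t' : homoclinic act (x t) (x t').
  apply: (homoclinic_of_close cX ca expU0 clU _ (xU t t')).
  by move=> [y z] /UP[].
have fx_inj : injective (f \o x).
  move=> t t' fxtt; apply: x_inj.
  by apply: (injf (x t)) => //; rewrite inE; exact: x_homo.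
pose W := [fset f (x t) | t : T]%fset.
have cardW : #|` W| = #|{: T}| by rewrite card_imfset //= -cardE.
have [Z0 [Z0Y sepZ0 boundZ0]] := sep_max act cX hX (range f) F entU0.
(* Positivity allows s(F) to be cancelled at the end. *)
have Z0_gt0 : (0 < #|` Z0|)%N.
  rewrite -(cardfs1 (f p)); apply: boundZ0 => [z|y z].
    by rewrite inE => /eqP->; exists p.
  by rewrite !inE => /eqP-> /eqP->.
(* Off LF the images are never [U0]-separated, so expansiveness separates them within LF, which lies
   in the union of LF \ F and F. *)
have upper : (#|{: T}| <= C ^ d * #|` Z0|)%N.
  rewrite -cardW; apply: (boundU (range f) F (fset_mulg L F `\` F)%fset) => //.
    by move=> z /imfsetP[t /= _ ->]; exists (x t).
  move=> y z /imfsetP[t /= _ ->] /imfsetP[t' /= _ ->] /expU0[g Ug].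
  exists g => //; apply/fsetUP.
  have [gF|gF] := boolP (g \in F); [by right|left].
  rewrite inE gF /=; apply: contraT => /(xU t t')/UP[_ + _].
  by rewrite !eqf.
(* Restoring LA to F \ LA costs at most C^|LA| <= c^|A|. The extra factor c^|S \ A| clears
   denominators, and its sum over [A] is (c + 1)^|S|. *)
have lower (A : {set S}) :
    (c ^ #|~: A| * #|` Z0| <= c ^ #|` S| * #|` Z A|)%N.
  rewrite [in leqRHS]cardfE -(cardsC A) addnC expnD -mulnA leq_mul2l.
  apply/orP; right; have [_ _ bZA] := ZP A.
  pose A' := [fset val a | a in A]%fset.
  have cardA' : #|` A'| = #|A|.
    by rewrite card_imfset //= -?cardE //; exact: val_inj.
  apply: (@leq_trans (C ^ #|` fset_mulg L A'| * #|` Z A|)); last first.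
    rewrite leq_mul2r -expnM leq_pexp2l ?orbT //.
    by rewrite -cardA'; exact: card_fset_mulg.
  suff FLAB : {subset F <= fset_mulg L A' `|` B A}%fset.
    exact: (sep_bound_sub FLAB (boundU _ _ _ _ bZA)) Z0Y sepZ0.
  move=> g gF.
  apply/fsetUP; have [|gB] := boolP (g \in B A); [by right|left].
  have [a aA gaL] : exists2 a, a \in A & (g * (val a)^-1)%g \in L.
    apply: contrapT => aN; move/BP: gB; apply; split => // a aA.
    by apply/negP => gaL; apply: aN; exists a.
  apply/fset_mulgP; exists (g * (val a)^-1)%g, (val a); rewrite mulgVK.
  by split => //; apply/imfsetP; exists a.
have cardT : #|{: T}| = (\sum_(A : {set S}) #|` Z A|)%N.
  rewrite card_tagged sumnE big_map big_enum /=.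
  by apply: eq_bigr => A _; rewrite cardfE.
have : (c.+1 ^ #|` S| * #|` Z0| <= C ^ d * c ^ #|` S| * #|` Z0|)%N.
  rewrite -mulnA mulnCA; apply: leq_trans (leq_mul (leqnn _) upper).
  rewrite cardT big_distrr /= [X in (_ ^ X * _)%N]cardfE -sum_expn_setC.
  by rewrite big_distrl /=; apply: leq_sum => A _; exact: lower.
rewrite leq_pmul2r // leqNgt => /negP; apply.
exact: expn_gap CM.
Qed.

End MyhillProperty.

Theorem theorem1p1 (R : realType) (G : groupType) (X : topologicalType)
    (act : G -> X -> X)
    (X_compact : compact [set: X])
    (X_hausdorff : hausdorff_space X)
    (act_cont : continuous_action act)
    (G_amenable : amenable R G)
    (X_expansive : expansive act)
    (X_wsp : weak_specification act) :
  Myhill_property act /\ surjunctive act.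
Proof.
have myhill : Myhill_property act.
  by move=> f; exact: (@pre_injective_surjective _ _ _ _ _ _ R).
split => // f cf eqf injf; apply: myhill => // x y z _ _.
exact: injf.
Qed.
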